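(* For any $p>0$, there exist integers $N,m>0$ and symmetric matrices $A_0,\dots,A_N\in S^m$ such that, for the LMI-representable set $K=\{x\in\mathbb{R}^N : A_0+x_1A_1+\dots+x_NA_N\in S^m_+\}$, the metric projection $\Pi_K:\mathbb{R}^N\to\mathbb{R}^N$ fails to be $p$-order semismooth (i.e., there is a point at which it is not $p$-order semismooth).
   Context: $S^m$ is the space of real symmetric $m\times m$ matrices and $S^m_+$ the cone of positive semidefinite ones. A set of the displayed form is called LMI-representable (a spectrahedron). $\mathbb{R}^N$ has the Euclidean inner product and $\Pi_K(x)$ is the nearest point of $K$ to $x$. For a locally Lipschitz $f$, the Clarke generalized Jacobian $\partial f(x)$ is the convex hull of all limits of Jacobians $f'(x_k)$ along sequences $x_k\to x$ of differentiability points. For $p>0$, $f$ is $p$-order semismooth at $x$ if it is directionally differentiable at $x$ and for any $V\in\partial f(x+h)$, $\|f(x+h)-f(x)-Vh\|=O(\|h\|^{1+p})$ as $h\to0$. *)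

(* Defs.v *)
From HB Require Import structures.
From mathcomp Require Import all_boot all_order all_algebra.
From mathcomp Require Import all_classical all_reals all_analysis.
Set Implicit Arguments. Unset Strict Implicit. Unset Printing Implicit Defensive.
Import Order.TTheory GRing.Theory Num.Theory.
Import numFieldNormedType.Exports.
Local Open Scope classical_set_scope.
Local Open Scope ring_scope.

Section Defs.
Variable R : realType.

Definition edot (N : nat) (u v : 'rV[R]_N) : R := \sum_(i < N) u ord0 i * v ord0 i.
Definition enorm (N : nat) (u : 'rV[R]_N) : R := Num.sqrt (edot u u).

Definition symmx (m : nat) (A : 'M[R]_m) : Prop := A^T = A.

Definition psdmx (m : nat) (A : 'M[R]_m) : Prop :=
  symmx A /\ forall v : 'rV[R]_m, 0 <= (v *m A *m v^T) ord0 ord0.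

Definition spectrahedron (N m : nat) (A0 : 'M[R]_m) (A : 'I_N -> 'M[R]_m)
  : set 'rV[R]_N :=
  [set x | psdmx (A0 + \sum_(i < N) x ord0 i *: A i)].

Definition is_nearest (N : nat) (K : set 'rV[R]_N) (x y : 'rV[R]_N) : Prop :=
  K y /\ forall z, K z -> enorm (x - y) <= enorm (x - z).

(* Jacobian of f at x, as a matrix acting on row vectors: 'd f x h = h *m jac f x *)
Definition jac (N : nat) (f : 'rV[R]_N -> 'rV[R]_N) (x : 'rV[R]_N) : 'M[R]_N :=
  lin1_mx ('d f x).

Definition bjac (N : nat) (f : 'rV[R]_N -> 'rV[R]_N) (x : 'rV[R]_N) : set 'M[R]_N :=
  [set J | exists u : nat -> 'rV[R]_N,
     (u @ \oo --> x) /\ (forall k, differentiable f (u k)) /\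
     ((fun k => jac f (u k)) @ \oo --> J)].

Definition clarke (N : nat) (f : 'rV[R]_N -> 'rV[R]_N) (x : 'rV[R]_N) : set 'M[R]_N :=
  [set J | exists (n : nat) (l : 'I_n -> R) (Js : 'I_n -> 'M[R]_N),
     (forall i, 0 <= l i) /\ \sum_(i < n) l i = 1 /\
     (forall i, bjac f x (Js i)) /\ J = \sum_(i < n) l i *: Js i].

Definition dir_differentiable (N : nat) (f : 'rV[R]_N -> 'rV[R]_N) (x : 'rV[R]_N) : Prop :=
  forall h : 'rV[R]_N, exists l : 'rV[R]_N,
    (fun t : R => t^-1 *: (f (x + t *: h) - f x)) t @[t --> 0^'+] --> l.

Definition semismooth_order (p : R) (N : nat) (f : 'rV[R]_N -> 'rV[R]_N)
  (x : 'rV[R]_N) : Prop :=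
  dir_differentiable f x /\
  exists C : R, exists delta : R, 0 < C /\ 0 < delta /\
    forall h : 'rV[R]_N, enorm h < delta ->
      forall V : 'M[R]_N, clarke f (x + h) V ->
        enorm (f (x + h) - f x - h *m V) <= C * powR (enorm h) (1 + p).

End Defs.

(* Main.v *)
Require Import Defs.
From HB Require Import structures.
From mathcomp Require Import all_boot all_order all_algebra.
From mathcomp Require Import all_classical all_reals all_analysis.
From mathcomp Require Import ring lra zify.
Import Order.TTheory GRing.Theory Num.Theory.
Import numFieldNormedType.Exports.
Local Open Scope classical_set_scope.
Local Open Scope ring_scope.
Set Implicit Arguments. Unset Strict Implicit. Unset Printing Implicit Defensive.

(** Let K be the cone x_0 x_(k+2) >= x_(k+1)^2, 0 <= k <= n, and D = 2^(n+1). It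
    contains the curve z(s) = (1, s, s^2, s^4, ..., s^D), and the coordinate
    functional exposing the ray of e_0 grows only like s^D along it. Near the
    base point -e_last, which projects to 0, the polar cone of K is therefore
    bounded by a surface of regularity 1 + 1/(D-1), and Id - Pi_K is the projection
    onto that polar cone.

    Every point w z(s) + nu with w, s > 0 and nu in the relative interior of the
    normal cone at z(s) projects to w z(s). Moving (w, s, nu) linearly with h gives
    points whose projection is known and which lie at distance O(|h|^2) from
    w z(s) + nu + h, so nonexpansiveness of Pi_K yields differentiability and the
    explicit Jacobian, without any inverse function theorem. For w of order
    s^(D-1) and nu close to -e_last, the increment from the base point has size
    O(s^(D-1)), while the semismoothness residual is at least of order s^D; this
    exceeds C |h|^(1+p) as soon as (D-1) p >= 2 and s is small. *)

(** * Euclidean inner product and norm, compared with the max norm *)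

Section EuclideanSpace.
Context {R : realType} {N : nat}.
Implicit Types (u v w : 'rV[R]_N) (a : R).

Lemma edotC u v : edot u v = edot v u.
Proof. by apply: eq_bigr => i _; rewrite mulrC. Qed.

Lemma edotDl u v w : edot (u + v) w = edot u w + edot v w.
Proof. by rewrite -big_split; apply: eq_bigr => i _; rewrite !mxE mulrDl. Qed.

Lemma edotZl a u v : edot (a *: u) v = a * edot u v.
Proof. by rewrite [RHS]mulr_sumr; apply: eq_bigr => i _; rewrite !mxE mulrA. Qed.

Lemma edotNl u v : edot (- u) v = - edot u v.
Proof. by rewrite -scaleN1r edotZl mulN1r. Qed.

Lemma edotDr u v w : edot u (v + w) = edot u v + edot u w.
Proof. by rewrite edotC edotDl !(edotC _ u). Qed.

Lemma edotZr a u v : edot u (a *: v) = a * edot u v.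
Proof. by rewrite edotC edotZl edotC. Qed.

Lemma edotNr u v : edot u (- v) = - edot u v.
Proof. by rewrite edotC edotNl edotC. Qed.

Definition edotE := (edotDl, edotDr, edotNl, edotNr, edotZl, edotZr).

Lemma edot_subZ u v a :
  edot (u - a *: v) (u - a *: v) = edot u u - 2 * a * edot u v + a ^+ 2 * edot v v.
Proof. by rewrite !edotE (edotC v u); ring. Qed.

Lemma edot_ge0 u : 0 <= edot u u.
Proof. by apply: sumr_ge0 => i _; rewrite -expr2 sqr_ge0. Qed.

Lemma edot_delta u i : edot u (delta_mx ord0 i) = u ord0 i.
Proof.
rewrite /edot (bigD1 i)//= mxE !eqxx mulr1 big1 ?addr0// => j ji.
by rewrite mxE (negbTE ji) andbF mulr0.
Qed.

Lemma edot_delta_l u i : edot (delta_mx ord0 i) u = u ord0 i.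
Proof. by rewrite edotC edot_delta. Qed.

Lemma sqr_coord_le_edot u i : u ord0 i ^+ 2 <= edot u u.
Proof.
rewrite /edot (bigD1 i)//= -expr2 lerDl sumr_ge0// => j _.
by rewrite -expr2 sqr_ge0.
Qed.

Lemma edot_cauchy_schwarz u v : edot u v ^+ 2 <= edot u u * edot v v.
Proof.
have [u0|u0] := eqVneq (edot u u) 0.
  have uE : u = 0.
    apply/rowP => i; rewrite mxE; apply/eqP; rewrite -sqrf_eq0 eq_le sqr_ge0.
    by rewrite andbT -u0 sqr_coord_le_edot.
  by rewrite u0 uE -(scale0r v) edotZl !mul0r expr0n.
(* The squared norm of this vector is [|u|^2 (|u|^2 |v|^2 - <u,v>^2)]. *)
have := edot_ge0 (edot u u *: v - edot u v *: u); rewrite !edotE (edotC v u).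
have ugt0 : 0 < edot u u by rewrite lt_neqAle eq_sym u0 edot_ge0.
rewrite -(pmulr_rge0 _ ugt0) => H; rewrite -subr_ge0 -(pmulr_rge0 _ ugt0).
move: H; rewrite pmulr_rge0//; nra.
Qed.

Lemma mx_norm_coord u i : `|u ord0 i| <= `|u|.
Proof.
by rewrite [leRHS]/Num.norm /= mx_normrE; apply/bigmax_geP; right; exists (ord0, i).
Qed.

Lemma mx_norm_leP u a : 0 <= a -> (forall i, `|u ord0 i| <= a) -> `|u| <= a.
Proof.
move=> a0 ua; rewrite [leLHS]/Num.norm /= mx_normrE; apply/bigmax_leP.
by split => // -[i j] _ /=; rewrite ord1.
Qed.

Lemma norm_edot_le u v : `|edot u v| <= N%:R * (`|u| * `|v|).
Proof.
rewrite (le_trans (ler_norm_sum _ _ _))//.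
have -> : N%:R * (`|u| * `|v|) = \sum_(i < N) `|u| * `|v|.
  by rewrite sumr_const card_ord mulr_natl.
by apply: ler_sum => i _; rewrite normrM ler_pM ?mx_norm_coord.
Qed.

Lemma enorm_ge0 u : 0 <= enorm u.
Proof. exact: sqrtr_ge0. Qed.

Lemma mx_norm_le_enorm u : `|u| <= enorm u.
Proof.
apply: mx_norm_leP (enorm_ge0 u) _ => i.
by rewrite -sqrtr_sqr ler_wsqrtr// sqr_coord_le_edot.
Qed.

Lemma enorm_le_mx_norm u : enorm u <= N%:R * `|u|.
Proof.
have uN : edot u u <= (N%:R * `|u|) ^+ 2.
  rewrite (le_trans (ler_norm _))// (le_trans (norm_edot_le u u))//.
  rewrite -expr2 exprMn ler_wpM2r ?sqr_ge0// -natrX ler_nat.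
  by rewrite -mulnn; nia.
by rewrite -[leRHS]ger0_norm ?mulr_ge0// -sqrtr_sqr ler_wsqrtr.
Qed.

Lemma edot_continuous (v : 'rV[R]_N) : continuous (fun u : 'rV[R]_N => edot u v).
Proof.
apply: (continuous_big (op := +%R)) => [|i _ u]; first exact: add_continuous.
apply: (@continuousM _ _ (fun y : 'rV[R]_N => y ord0 i)); last exact: cst_continuous.
exact: (@coord_continuous R 1 N ord0 i).
Qed.

Lemma sqr_enorm_continuous (x : 'rV[R]_N) :
  continuous (fun u : 'rV[R]_N => edot (x - u) (x - u)).
Proof.
rewrite /edot; apply: (continuous_big (op := +%R)) => [|i _ u].
  exact: add_continuous.
have cx : continuous (fun y : 'rV[R]_N => (x - y) ord0 i).
  have -> : (fun y : 'rV[R]_N => (x - y) ord0 i) =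
      (fun y => x ord0 i - y ord0 i) by apply/funext => y; rewrite !mxE.
  move=> y; apply: (@continuousB _ _ _ (fun=> x ord0 i)).
    exact: cst_continuous.
  exact: (@coord_continuous R 1 N ord0 i).
exact: continuousM (cx u) (cx u).
Qed.

End EuclideanSpace.

(** * Nearest points of closed convex sets *)

Section Projection.
Context {R : realType} {N : nat} (K : set 'rV[R]_N).

(** Only the points of [K] at most as far from [x] as a fixed [y0] in [K] compete, and they form a
    compact set. *)
Lemma nearest_exists (x : 'rV[R]_N) : closed K -> K !=set0 ->
  exists y, is_nearest K x y.
Proof.
move=> Kc [y0 Ky0].
pose r := edot (x - y0) (x - y0).
pose A := K `&` [set y | edot (x - y) (x - y) <= r].
have A0 : A !=set0 by exists y0; split => //=; exact: lexx.
have Ac : compact A.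
  apply: bounded_closed_compact.
    exists (`|x| + Num.sqrt r); split; first by rewrite num_real.
    move=> b rb y [_ yr] /=; apply: le_trans (ltW rb).
    rewrite -[y](subKr x) (le_trans (ler_normB _ _))// lerD2l.
    by rewrite (le_trans (mx_norm_le_enorm _))// ler_wsqrtr.
  apply: closedI => //.
  have /continuous_closedP/(_ _ (@closed_le R r)) := @sqr_enorm_continuous R N x.
  exact.
have [|y /set_mem[Ky yr] ymin] :=
  @EVT_min_rV R N (fun y => edot (x - y) (x - y)) A A0 Ac.
  by apply: continuous_subspaceT => y; exact: sqr_enorm_continuous.
exists y; split=> // z Kz; apply: ler_wsqrtr.
have [zr|rz] := leP (edot (x - z) (x - z)) r; first by apply: ymin; exact/mem_set.
exact: le_trans yr (ltW rz).
Qed.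

Lemma nearest_variational x y z :
  (forall u v (t : R), K u -> K v -> 0 <= t <= 1 -> K (t *: u + (1 - t) *: v)) ->
  is_nearest K x y -> K z -> edot (x - y) (z - y) <= 0.
Proof.
move=> Kconv [Ky ymin] Kz; rewrite leNgt; apply/negP => xyz.
set e := edot (x - y) (z - y) in xyz; set q := edot (z - y) (z - y).
have q0 : 0 <= q by exact: edot_ge0.
(* Moving from [y] towards [z] by [t] changes the squared distance to [x] by [- 2 t e + t^2 q]. As
   [t (e + q) = e], this equals [- t e - t^2 e < 0], even when [q = 0]. *)
pose t := e / (e + q).
have t01 : 0 < t <= 1 by rewrite divr_gt0 ?ltr_wpDr//= ler_pdivrMr ?mul1r ?lerDl// ltr_wpDr.
have [t0 t1] := andP t01.
have := ymin _ (Kconv z y t Kz Ky (introT andP (conj (ltW t0) t1))).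
rewrite ler_sqrt ?edot_ge0//.
have -> : x - (t *: z + (1 - t) *: y) = (x - y) - t *: (z - y).
  by apply/rowP => i; rewrite !mxE; ring.
rewrite edot_subZ -/e -/q.
have te : t * (e + q) = e by rewrite divfK// gt_eqF// ltr_wpDr.
nra.
Qed.

(* The last hypothesis says that [y] is the projection of [c]. *)
Lemma nearest_nonexpansive x px y c :
  (forall u v (t : R), K u -> K v -> 0 <= t <= 1 -> K (t *: u + (1 - t) *: v)) ->
  is_nearest K x px -> K y -> (forall z, K z -> edot (c - y) (z - y) <= 0) ->
  enorm (px - y) <= enorm (x - c).
Proof.
move=> Kconv xpx Ky cy.
have h1 := nearest_variational Kconv xpx Ky; have h2 := cy _ xpx.1.
apply: ler_wsqrtr.
have dE : edot (px - y) (px - y) =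
    edot (x - c) (px - y) - edot (x - px) (px - y) + edot (c - y) (px - y).
  by rewrite -edotNl -!edotDl; congr edot; apply/rowP => i; rewrite !mxE; ring.
(* [h1], [h2], [dE] give [|px - y|^2 <= <x - c, px - y>]; expanding this square turns that into
   [|px - y|^2 <= |x - c|^2]. *)
have := edot_ge0 ((x - c) - 1 *: (px - y)).
by move: h1 h2 dE; rewrite -[y - px]opprB edotNr edot_subZ; lra.
Qed.

End Projection.

(** * Cones defined by homogeneous LMIs *)

Section SpectrahedralCone.
Context {R : realType} {N m : nat} (A : 'I_N -> 'M[R]_m).
Hypothesis symA : forall i, symmx (A i).

(** The form of the pencil at a fixed [v] is linear in [x], so the cone is an intersection of closed
    half-spaces; closedness and convexity are read off from this. *)
Lemma spectrahedron0E x : spectrahedron 0 A x <->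
  forall v : 'rV[R]_m, 0 <= edot x (\row_i (v *m A i *m v^T) ord0 ord0).
Proof.
have formE v : (v *m (0 + \sum_i x ord0 i *: A i) *m v^T) ord0 ord0 =
    edot x (\row_i (v *m A i *m v^T) ord0 ord0).
  rewrite add0r mulmx_sumr mulmx_suml summxE; apply: eq_bigr => i _.
  by rewrite -scalemxAr -scalemxAl !mxE.
split=> [[_ Ax] v|Ax]; first by rewrite -formE.
split=> [|v]; last by rewrite formE.
rewrite /symmx add0r linear_sum; apply: eq_bigr => i _ /=.
by rewrite linearZ /= symA.
Qed.

Lemma spectrahedron0_closed : closed (spectrahedron 0 A).
Proof.
have -> : spectrahedron 0 A = \bigcap_(v : 'rV[R]_m)
    [set x | 0 <= edot x (\row_i (v *m A i *m v^T) ord0 ord0)].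
  apply/seteqP; split=> x; first by move=> /spectrahedron0E Ax v _; exact: Ax.
  by move=> Ax; apply/spectrahedron0E => v; exact: Ax.
apply: closed_bigI => v _.
set w := \row_i _.
have /continuous_closedP/(_ _ (@closed_ge R 0)) := @edot_continuous R N w.
exact.
Qed.

Lemma spectrahedron0_convex u v (t : R) : spectrahedron 0 A u ->
  spectrahedron 0 A v -> 0 <= t <= 1 -> spectrahedron 0 A (t *: u + (1 - t) *: v).
Proof.
move=> /spectrahedron0E Au /spectrahedron0E Av /andP[t0 t1].
apply/spectrahedron0E => w; rewrite !edotE.
by rewrite addr_ge0// mulr_ge0// subr_ge0.
Qed.

End SpectrahedralCone.

(** * The chain cone and the curve on its boundary *)

Section ChainCone.
Context {R : realType} (n : nat).
Local Notation N := (n.+3).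
Local Notation "x `[ j ]" := (x ord0 (inord j : 'I_N)) (at level 2, format "x `[ j ]").

(** Up to a permutation the pencil is the direct sum of the 2x2 blocks [[x_0, x_(k+1)],
    [x_(k+1), x_(k+2)]]; here the first rows of all blocks precede the second rows, which leaves
    four diagonal matrices. *)
Definition chain_mx (i : 'I_N) : 'M[R]_(n.+1 + n.+1) :=
  let D j := diag_mx (\row_(k < n.+1) (i == inord (j + k))%:R) in
  block_mx (i == ord0)%:R%:M (D 1%N) (D 1%N) (D 2%N).

Lemma chain_mx_sym i : symmx (chain_mx i).
Proof. by rewrite /symmx /chain_mx tr_block_mx tr_scalar_mx !tr_diag_mx. Qed.

Lemma sum_eqind (x : 'I_N -> R) j : \sum_i x i * (i == j)%:R = x j.
Proof.
rewrite (bigD1 j)//= eqxx mulr1 big1 ?addr0// => i /negbTE ->.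
by rewrite mulr0.
Qed.

Definition chain_form (x : 'rV[R]_N) k (p q : R) :=
  x`[0] * p ^+ 2 + 2 * x`[k.+1] * (p * q) + x`[k.+2] * q ^+ 2.

Lemma chain_mx_form (x : 'rV[R]_N) (p q : 'rV[R]_n.+1) :
  edot x (\row_i (row_mx p q *m chain_mx i *m (row_mx p q)^T) ord0 ord0) =
  \sum_(k < n.+1) chain_form x k (p ord0 k) (q ord0 k).
Proof.
have formE i : (row_mx p q *m chain_mx i *m (row_mx p q)^T) ord0 ord0 =
  \sum_k ((i == inord 0)%:R * p ord0 k ^+ 2 +
   (i == inord k.+1)%:R * (2 * (p ord0 k * q ord0 k)) +
   (i == inord k.+2)%:R * q ord0 k ^+ 2).
  rewrite mul_row_block tr_row_mx mul_row_col mul_mx_scalar !mul_mx_diag.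
  rewrite !mxE -big_split; apply: eq_bigr => k _ /=; rewrite !mxE.
  have -> : ord0 = inord 0 :> 'I_N by apply/val_inj; rewrite /= inordK.
  by rewrite add1n add2n; ring.
rewrite /edot; under eq_bigr do rewrite mxE formE mulr_sumr.
rewrite exchange_big /=; apply: eq_bigr => k _.
under eq_bigr do rewrite !mulrDr !mulrA.
rewrite !big_split /= -!mulr_suml !sum_eqind /chain_form; ring.
Qed.

Lemma chain_coneP x : spectrahedron 0 chain_mx x <->
  forall k p q, (k <= n)%N -> 0 <= chain_form x k p q.
Proof.
split=> [/(spectrahedron0E chain_mx_sym) Kx k p q kn|Kx].
  (* A test vector supported on the two rows of block [k] isolates that block. *)
  pose e := delta_mx ord0 (inord k) : 'rV[R]_n.+1.
  have := Kx (row_mx (p *: e) (q *: e)); rewrite chain_mx_form.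
  rewrite (bigD1 (inord k))//= big1 => [|j jk].
    by rewrite addr0 !mxE !eqxx !mulr1 inordK.
  by rewrite /chain_form !mxE (negbTE jk) andbF !mulr0 expr0n !mulr0 !addr0.
apply/(spectrahedron0E chain_mx_sym) => v; rewrite -[v]hsubmxK chain_mx_form.
by apply: sumr_ge0 => k _; apply: Kx; rewrite -ltnS ltn_ord.
Qed.

(** The degrees 0, 1, 2, 4, ... double from index 1 on, which makes every 2x2 block singular along
    the curve. *)
Definition chain_deg j := if j is k.+1 then (2 ^ k)%N else 0%N.

Definition curve (s : R) : 'rV[R]_N := \row_i s ^+ chain_deg i.
(** Here and in [ddcurve], wherever a predecessor is truncated at 0, the coefficient of the power
    vanishes. *)
Definition dcurve (s : R) : 'rV[R]_N :=
  \row_i ((chain_deg i)%:R * s ^+ (chain_deg i).-1).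
Definition ddcurve (s : R) : 'rV[R]_N :=
  \row_i ((chain_deg i)%:R * ((chain_deg i).-1%:R * s ^+ (chain_deg i).-2)).

(** The blocks have rank at most one at [w *: curve s]: their forms are [w (p + t q)^2]. *)
Lemma curve_chain_cone (w s : R) : 0 <= w -> spectrahedron 0 chain_mx (w *: curve s).
Proof.
move=> w0; apply/chain_coneP => k p q kn.
have k1 : (k.+1 < N)%N by rewrite !ltnS leqW.
rewrite /chain_form !mxE !inordK//=.
have -> : s ^+ (2 ^ k.+1) = (s ^+ (2 ^ k)) ^+ 2 by rewrite -exprM expnSr.
rewrite expr0; set t := s ^+ _.
have -> : w * 1 * p ^+ 2 + 2 * (w * t) * (p * q) + w * t ^+ 2 * q ^+ 2 =
  w * (p + t * q) ^+ 2 by ring.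
by rewrite mulr_ge0// sqr_ge0.
Qed.

(* On the cone the [j]-th coordinate dominates [x_1 ^ d_j / x_0 ^ (d_j - 1)]; this
   is the tangent-line form of that convex inequality at slope [x_1 / x_0 = s]. *)
Lemma chain_cone_tangent (s : R) x j : 0 <= s -> spectrahedron 0 chain_mx x ->
  (j < N)%N ->
  s ^+ chain_deg j * x`[0]
    + (chain_deg j)%:R * s ^+ (chain_deg j).-1 * (x`[1] - s * x`[0]) <= x`[j].
Proof.
move=> s0 /chain_coneP Kx; case: j => [_|j] /=.
  by rewrite expr0 !mul0r addr0 mul1r.
elim: j => [_|j IH jN]; first by rewrite expn0 expr1 expr0 mul1r mul1r; lra.
have {IH} := IH (ltnW jN).
(* With [t = s^(2^j)] this reads [x_(j+2) >= 2 t x_(j+1) - t^2 x_0], into which the induction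
   hypothesis for [x_(j+1)] is inserted. *)
have := Kx j (s ^+ (2 ^ j)) (- 1) jN; rewrite /chain_form.
have dE : (2 ^ j.+1 = 2 ^ j * 2)%N by rewrite expnSr.
have d1 : (2 ^ j.+1).-1 = (2 ^ j + (2 ^ j).-1)%N.
  by have := expn_gt0 2 j; rewrite dE; move: (2 ^ j)%N => d; lia.
rewrite d1 dE exprD natrM exprM.
have : 0 <= s ^+ (2 ^ j) by rewrite exprn_ge0.
move: (s ^+ (2 ^ j)) (s ^+ (2 ^ j).-1) (2 ^ j)%:R => t t' d t0.
move: x`[0] x`[1] x`[j.+1] x`[j.+2] => x0 x1 y y' h1 h2.
have : 0 <= 2 * t * (y - (t * x0 + d * t' * (x1 - s * x0))).
  by rewrite mulr_ge0 ?mulr_ge0// subr_ge0.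
lra.
Qed.

End ChainCone.

(** * Differentiability from a quadratic remainder, and Clarke elements *)

Lemma differentiable_quadratic_remainder {R : realType} {V W : normedModType R}
    (f : V -> W) (a : V) (df : {linear V -> W}) (C delta : R) :
  continuous df -> 0 < delta ->
  (forall h, `|h| <= delta -> `|f (a + h) - f a - df h| <= C * `|h| ^+ 2) ->
  differentiable f a /\ 'd f a = df :> (V -> W).
Proof.
move=> cdf d0 fdf.
have fE : f \o shift a = cst (f a) + df +o_ 0 id.
  apply/eqaddoP => e e0; near=> h.
  have -> : (f \o shift a - (cst (f a) + df)) h = f (a + h) - f a - df h.
    by rewrite /= !fctE /= [h + a]addrC opprD addrA.
  have hd : `|h| <= delta by near: h; exact: nbhs0_le.
  have C1 : 0 < `|C| + 1 by rewrite ltr_wpDl.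
  have hC : `|h| <= e / (`|C| + 1) by near: h; apply: nbhs0_le; rewrite divr_gt0.
  rewrite (le_trans (fdf h hd))//= expr2 mulrA ler_wpM2r//.
  move: hC; rewrite ler_pdivlMr// => hC; apply: le_trans hC.
  by rewrite mulrC ler_wpM2l// (le_trans (ler_norm C))// lerDl.
have dE := diff_unique cdf fE.
by split=> //; apply/diff_locallyP; rewrite dE.
Unshelve. all: by end_near. Qed.

Section Differentiability.
Context {R : realType} {N : nat}.

Lemma mulmxr_continuous (M : 'M[R]_N) :
  continuous (mulmxr M : 'rV[R]_N -> 'rV[R]_N).
Proof.
apply/bounded_linear_continuous/bounded_funP => r.
exists (N%:R * (r * `|M|)) => x xr.
have [r0|r0] := ltP r 0; first by have := normr_ge0 x; lra.
apply: mx_norm_leP => [|j]; first by rewrite !mulr_ge0.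
have -> : (x *m M) ord0 j = edot x (\row_i M i j).
  by rewrite mxE; apply: eq_bigr => i _; rewrite mxE.
rewrite (le_trans (norm_edot_le _ _))// ler_wpM2l// ler_pM//.
apply: mx_norm_leP => // i; rewrite mxE [leRHS]/Num.norm /= mx_normrE.
by apply/bigmax_geP; right; exists (i, j).
Qed.

(** A constant sequence and a one-term convex combination suffice, so semismoothness can be tested
    against the Jacobian itself. *)
Lemma clarke_jac (f : 'rV[R]_N -> 'rV[R]_N) x :
  differentiable f x -> clarke f x (jac f x).
Proof.
move=> df; exists 1%N, (fun=> 1), (fun=> jac f x); rewrite !big_ord1 scale1r.
split=> //; split=> //; split=> // _; exists (fun=> x).
by split; [exact: cvg_cst|split=> //; exact: cvg_cst].
Qed.

End Differentiability.

(** * Calculus of orders of vanishing on a fixed ball *)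

Section Asymptotics.
Context {R : realType} {N : nat} (delta : R).
Hypothesis delta_le1 : delta <= 1.

(** [f h = O(|h|^k)] on one ball of radius [delta], shared by all functions so that sums and
    products need no shrinking; [delta <= 1] makes higher order imply lower order. *)
Definition ordO (V : normedModType R) k (f : 'rV[R]_N -> V) :=
  exists2 C : R, 0 <= C & forall h, `|h| <= delta -> `|f h| <= C * `|h| ^+ k.

Lemma ordO_cst (V : normedModType R) (v : V) : ordO 0 (fun=> v).
Proof. by exists `|v| => // h _; rewrite expr0 mulr1. Qed.

Lemma ordO_le (V : normedModType R) k l (f : 'rV[R]_N -> V) :
  (k <= l)%N -> ordO l f -> ordO k f.
Proof.
move=> kl [C C0 Cf]; exists C => // h hd; rewrite (le_trans (Cf h hd))//.
by rewrite ler_wpM2l// ler_wiXn2l// (le_trans hd).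
Qed.

Lemma ordOD (V : normedModType R) k (f g : 'rV[R]_N -> V) :
  ordO k f -> ordO k g -> ordO k (fun h => f h + g h).
Proof.
move=> [C C0 Cf] [B B0 Bg]; exists (C + B); first exact: addr_ge0.
by move=> h hd; rewrite (le_trans (ler_normD _ _))// mulrDl lerD ?Cf ?Bg.
Qed.

Lemma ordON (V : normedModType R) k (f : 'rV[R]_N -> V) :
  ordO k f -> ordO k (fun h => - f h).
Proof. by move=> [C C0 Cf]; exists C => // h hd; rewrite normrN Cf. Qed.

Lemma ordOZ (V : normedModType R) k l (a : 'rV[R]_N -> R) (f : 'rV[R]_N -> V) :
  ordO k a -> ordO l f -> ordO (k + l) (fun h => a h *: f h).
Proof.
move=> [C C0 Ca] [B B0 Bf]; exists (C * B); first exact: mulr_ge0.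
move=> h hd; rewrite normrZ exprD.
have -> : C * B * (`|h| ^+ k * `|h| ^+ l) = (C * `|h| ^+ k) * (B * `|h| ^+ l) by ring.
by rewrite ler_pM ?Ca ?Bf.
Qed.

Lemma ordO_edot k l (f g : 'rV[R]_N -> 'rV[R]_N) :
  ordO k f -> ordO l g -> ordO (k + l) (fun h => edot (f h) (g h)).
Proof.
move=> [C C0 Cf] [B B0 Bg]; exists (N%:R * (C * B)); first by rewrite !mulr_ge0.
move=> h hd; rewrite (le_trans (norm_edot_le _ _))// exprD -mulrA ler_wpM2l//.
have -> : C * B * (`|h| ^+ k * `|h| ^+ l) = (C * `|h| ^+ k) * (B * `|h| ^+ l) by ring.
by rewrite ler_pM ?Cf ?Bg.
Qed.

Lemma ordO_id : ordO 1 (@id 'rV[R]_N).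
Proof. by exists 1 => // h _; rewrite mul1r expr1. Qed.

End Asymptotics.

(** * Normal vectors along the curve and Taylor bounds *)

Section ChainNormals.
Context {R : realType} {n : nat}.
Local Notation N := (n.+3).
Local Notation D := (2 ^ n.+1)%N.
Local Notation z := (@curve R n).
Local Notation z' := (@dcurve R n).
Local Notation z'' := (@ddcurve R n).
Local Notation K := (spectrahedron 0 (@chain_mx R n)).
Local Notation e0 := (delta_mx ord0 (inord 0) : 'rV[R]_N).
Local Notation e1 := (delta_mx ord0 (inord 1) : 'rV[R]_N).

Implicit Types (s w : R) (mu x : 'rV[R]_N).

(** Together with [e0] this is dual to the pair [z s], [z' s]: it pairs to 0 with the first and to 1
    with the second. *)
Definition slope_dir (s : R) : 'rV[R]_N := e1 - s *: e0.

(* Up to sign, the projection of [mu] onto the orthogonal complement of [z s] and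
   [z' s] along the plane of the first two coordinates. *)
Definition normal (s : R) (mu : 'rV[R]_N) : 'rV[R]_N :=
  edot mu (z s) *: e0 + edot mu (z' s) *: slope_dir s - mu.

Lemma curve_coord0 s : z s ord0 (inord 0) = 1.
Proof. by rewrite mxE inordK// expr0. Qed.

Lemma curve_coord1 s : z s ord0 (inord 1) = s.
Proof. by rewrite mxE inordK// expr1. Qed.

Lemma dcurve_coord0 s : z' s ord0 (inord 0) = 0.
Proof. by rewrite mxE inordK// mul0r. Qed.

Lemma dcurve_coord1 s : z' s ord0 (inord 1) = 1.
Proof. by rewrite mxE inordK// mul1r expr0. Qed.

Lemma edot_slope_dir_curve s : edot (slope_dir s) (z s) = 0.
Proof. by rewrite !edotE !edot_delta_l curve_coord0 curve_coord1; ring. Qed.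

Lemma edot_slope_dir_dcurve s : edot (slope_dir s) (z' s) = 1.
Proof. by rewrite !edotE !edot_delta_l dcurve_coord0 dcurve_coord1; ring. Qed.

Lemma edot_normal_curve s mu : edot (normal s mu) (z s) = 0.
Proof.
rewrite /normal 2!edotDl 2!edotZl edotNl edot_slope_dir_curve edot_delta_l.
by rewrite curve_coord0; ring.
Qed.

Lemma edot_normal_dcurve s mu : edot (normal s mu) (z' s) = 0.
Proof.
rewrite /normal 2!edotDl 2!edotZl edotNl edot_slope_dir_dcurve edot_delta_l.
by rewrite dcurve_coord0; ring.
Qed.

(** The pairing is a sum of [mu] coordinates times gaps in [chain_cone_tangent]. With
    [edot_normal_curve], this puts [normal s mu] in the normal cone of [K] at [w *: z s]. *)
Lemma normal_polar s mu x : 0 <= s -> (forall i, 0 <= mu ord0 i) -> K x ->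
  edot (normal s mu) x <= 0.
Proof.
move=> s0 mu0 Kx.
have -> : edot (normal s mu) x = \sum_i mu ord0 i * (s ^+ chain_deg i * x ord0 (inord 0)
    + (chain_deg i)%:R * s ^+ (chain_deg i).-1 *
      (x ord0 (inord 1) - s * x ord0 (inord 0)) - x ord0 i).
  rewrite /normal /slope_dir !edotE !edot_delta_l /edot.
  rewrite !mulr_suml -!big_split -sumrB /=; apply: eq_bigr => i _.
  by rewrite !mxE; ring.
rewrite sumr_le0// => i _; rewrite mulr_ge0_le0// subr_le0.
have := chain_cone_tangent s0 Kx (ltn_ord i).
by rewrite inord_val.
Qed.

(* [w *: z s] is the projection of [w *: z s + normal s mu]. *)
Lemma projection_curve x px w s mu : is_nearest K x px ->
  0 <= w -> 0 <= s -> (forall i, 0 <= mu ord0 i) ->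
  enorm (px - w *: z s) <= enorm (x - (w *: z s + normal s mu)).
Proof.
move=> xpx w0 s0 mu0; apply: nearest_nonexpansive xpx _ _.
- exact: (spectrahedron0_convex (@chain_mx_sym R n)).
- exact: curve_chain_cone.
- move=> y Ky; rewrite addrAC subrr add0r edotDr edotNr edotZr edot_normal_curve.
  by rewrite mulr0 subr0 normal_polar.
Qed.

Lemma chain_deg_le (i : 'I_N) : (chain_deg i <= D)%N.
Proof.
case: i => -[|i] iN //=; rewrite leq_exp2l//; exact: iN.
Qed.

(** The remainders satisfy [r_(k+1) = (s + g) r_k + g^2 k s^(k-1)], and [k^2 + k <= (k+1)^2] closes
    the induction. *)
Lemma expr_taylor1 (s g : R) k : `|g| <= 1 ->
  `|(s + g) ^+ k - s ^+ k - g * (k%:R * s ^+ k.-1)| <=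
  k%:R ^+ 2 * (`|s| + 1) ^+ k * g ^+ 2.
Proof.
move=> g1; have s1 : 1 <= `|s| + 1 by rewrite lerDr.
elim: k => [|k IH].
  by rewrite !expr0 subrr mul0r mulr0 subrr normr0 expr0n !mul0r.
have -> : (s + g) ^+ k.+1 - s ^+ k.+1 - g * (k.+1%:R * s ^+ k.+1.-1) =
  (s + g) * ((s + g) ^+ k - s ^+ k - g * (k%:R * s ^+ k.-1))
    + g ^+ 2 * (k%:R * s ^+ k.-1).
  by case: k {IH} => [|k] /=; rewrite ?exprS -?natr1; ring.
rewrite (le_trans (ler_normD _ _))// !normrM normr_nat normrX.
have sM : `|s| ^+ k.-1 <= (`|s| + 1) ^+ k.+1.
  rewrite (@le_trans _ _ ((`|s| + 1) ^+ k.-1))//.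
    by rewrite lerXn2r ?nnegrE ?lerDl ?addr_ge0.
  by rewrite ler_weXn2l// (leq_trans (leq_pred k)).
have sg : `|s + g| <= `|s| + 1 by rewrite (le_trans (ler_normD _ _))// lerD2l.
have h1 := ler_pM (normr_ge0 _) (normr_ge0 _) sg IH.
have g2 : `|g| ^+ 2 = g ^+ 2 by rewrite real_normK ?num_real.
have h2 : `|g| ^+ 2 * (k%:R * `|s| ^+ k.-1) <=
    g ^+ 2 * (k%:R * (`|s| + 1) ^+ k.+1).
  by rewrite g2; apply: ler_wpM2l; [exact: sqr_ge0|exact: ler_wpM2l].
move: (lerD h1 h2) => /le_trans; rewrite [`|g| * `|g|]/(`|g| ^+ 2); apply.
rewrite -natr1 [(`|s| + 1) ^+ k.+1]exprS.
have : 0 <= (`|s| + 1) * (`|s| + 1) ^+ k * g ^+ 2.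
  apply: mulr_ge0; last exact: sqr_ge0.
  by apply: mulr_ge0; rewrite ?exprn_ge0// addr_ge0.
move=> MG; rewrite -subr_ge0.
set M := `|s| + 1 in MG *.
have -> : (k%:R + 1) ^+ 2 * (M * M ^+ k) * g ^+ 2 -
    (M * (k%:R ^+ 2 * M ^+ k * g ^+ 2) + g ^+ 2 * (k%:R * (M * M ^+ k))) =
    (k%:R + 1) * (M * M ^+ k * g ^+ 2) by ring.
by rewrite natr1; apply: mulr_ge0.
Qed.

Lemma expr_taylor1_unif (s g : R) k : `|g| <= 1 -> (k <= D)%N ->
  `|(s + g) ^+ k - s ^+ k - g * (k%:R * s ^+ k.-1)| <=
  D%:R ^+ 2 * (`|s| + 1) ^+ D * g ^+ 2.
Proof.
move=> g1 kD; rewrite (le_trans (expr_taylor1 _ _ g1))// ler_wpM2r ?sqr_ge0//.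
rewrite ler_pM ?exprn_ge0 ?addr_ge0//.
  by rewrite lerXn2r ?nnegrE// ler_nat.
by rewrite ler_weXn2l// lerDr.
Qed.

Lemma curve_taylor1 s g : `|g| <= 1 ->
  `|z (s + g) - z s - g *: z' s| <= D%:R ^+ 2 * (`|s| + 1) ^+ D * g ^+ 2.
Proof.
move=> g1; apply: mx_norm_leP => [|i].
  apply: mulr_ge0; last exact: sqr_ge0.
  by apply: mulr_ge0; rewrite exprn_ge0// addr_ge0.
by rewrite !mxE expr_taylor1_unif// chain_deg_le.
Qed.

Lemma dcurve_taylor1 s g : `|g| <= 1 ->
  `|z' (s + g) - z' s - g *: z'' s| <=
  D%:R * (D%:R ^+ 2 * (`|s| + 1) ^+ D) * g ^+ 2.
Proof.
move=> g1; apply: mx_norm_leP => [|i].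
  apply: mulr_ge0; last exact: sqr_ge0.
  by apply: mulr_ge0 => //; apply: mulr_ge0; rewrite exprn_ge0// addr_ge0.
rewrite !mxE mulrCA -mulrBr -mulrBr normrM normr_nat -mulrA.
have iD := chain_deg_le i.
by rewrite ler_pM// ?ler_nat// expr_taylor1_unif// (leq_trans (leq_pred _)).
Qed.

End ChainNormals.

(** * Derivative of the projection at [w *: z + normal s mu] *)

Section ProjectionDerivative.
Context {R : realType} {n : nat}.
Local Notation N := (n.+3).
Local Notation D := (2 ^ n.+1)%N.
Local Notation K := (spectrahedron 0 (@chain_mx R n)).
Local Notation e0 := (delta_mx ord0 (inord 0) : 'rV[R]_N).
Variables (w s m : R) (mu : 'rV[R]_N).
Local Notation z := (@curve R n s).
Local Notation z' := (@dcurve R n s).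
Local Notation z'' := (@ddcurve R n s).
Local Notation c := (@slope_dir R n s).
Local Notation q := (edot mu z'').
Hypotheses (w_gt0 : 0 < w) (s_gt0 : 0 < s) (m_gt0 : 0 < m).
Hypothesis mu_gem : forall i, m <= mu ord0 i.
Hypothesis q_gt0 : 0 < q.
Implicit Types d h : 'rV[R]_N.

(* Determinant of the linear system [alpha_gamma_curve], [alpha_gamma_dcurve]
   in [alpha d] and [gamma d]. *)
Definition pdet := edot z z * (w * edot z' z' + q) - w * edot z z' ^+ 2.

Lemma edot_curve_ge1 : 1 <= edot z z.
Proof. by have := sqr_coord_le_edot z (inord 0); rewrite curve_coord0 expr1n. Qed.

(** [pdet] is [<z,z> q] plus [w] times the Gram determinant of [z], [z'], which is nonnegative by
    Cauchy-Schwarz. *)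
Lemma pdet_gt0 : 0 < pdet.
Proof.
have := edot_cauchy_schwarz z z'; have := edot_curve_ge1; rewrite /pdet => Z1 ZW.
have -> : edot z z * (w * edot z' z' + q) - w * edot z z' ^+ 2 =
  edot z z * q + w * (edot z z * edot z' z' - edot z z' ^+ 2) by ring.
rewrite ltr_pwDl//; first by rewrite mulr_gt0// (lt_le_trans ltr01).
by rewrite mulr_ge0 ?(ltW w_gt0)// subr_ge0.
Qed.

(** Cramer's rule: [avec] and [gvec] represent the first-order changes of [w] and [s] as linear
    functionals of [d]. *)
Definition avec : 'rV[R]_N :=
  pdet^-1 *: ((w * edot z' z' + q) *: z - (w * edot z z') *: z').
Definition gvec : 'rV[R]_N := pdet^-1 *: (edot z z *: z' - edot z z' *: z).
Definition alpha d := edot d avec.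
Definition gamma d := edot d gvec.
(** For [beta] orthogonal to [z] and [z'], the derivative of [w *: z + normal s mu] along
    [(alpha, gamma, beta)] is [alpha z + gamma (w z' + q c) - beta]; equating it with [d] dictates
    [beta]. *)
Definition beta d := - (d - alpha d *: z - gamma d *: (w *: z' + q *: c)).

Lemma alphaE d : alpha d =
  ((w * edot z' z' + q) * edot d z - w * edot z z' * edot d z') / pdet.
Proof. by rewrite /alpha /avec edotZr edotDr edotNr !edotZr mulrC. Qed.

Lemma gammaE d : gamma d =
  (edot z z * edot d z' - edot z z' * edot d z) / pdet.
Proof. by rewrite /gamma /gvec edotZr edotDr edotNr !edotZr mulrC. Qed.

Lemma alpha_gamma_curve d :
  alpha d * edot z z + gamma d * (w * edot z z') = edot d z.
Proof.
have p0 : pdet != 0 by rewrite gt_eqF ?pdet_gt0.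
rewrite alphaE gammaE; move: p0; rewrite /pdet => p0; field; exact: p0.
Qed.

Lemma alpha_gamma_dcurve d :
  alpha d * edot z z' + gamma d * (w * edot z' z' + q) = edot d z'.
Proof.
have p0 : pdet != 0 by rewrite gt_eqF ?pdet_gt0.
rewrite alphaE gammaE; move: p0; rewrite /pdet => p0; field; exact: p0.
Qed.

(** As [c] is orthogonal to [z], this is the first equation of the linear system; the second one
    gives orthogonality to [z']. *)
Lemma edot_beta_curve d : edot (beta d) z = 0.
Proof.
rewrite /beta edotNl 2!edotDl 2!edotNl 2!edotZl edotDl 2!edotZl edot_slope_dir_curve.
by rewrite -(alpha_gamma_curve d) (edotC z' z); ring.
Qed.

Lemma edot_beta_dcurve d : edot (beta d) z' = 0.
Proof.
rewrite /beta edotNl 2!edotDl 2!edotNl 2!edotZl edotDl 2!edotZl edot_slope_dir_dcurve.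
by rewrite -(alpha_gamma_dcurve d); ring.
Qed.

(** The differential of [w *: z s] in [(w, s)] composed with [(alpha, gamma)]; on row vectors,
    [u^T *m v] is the map [d] to [<d,u> v]. *)
Definition pjac : 'M[R]_N := avec^T *m z + gvec^T *m (w *: z').

Lemma pjacE d : d *m pjac = alpha d *: z + gamma d *: (w *: z').
Proof.
have outerE (u v : 'rV[R]_N) : d *m (u^T *m v) = edot d u *: v.
  rewrite mulmxA; apply/rowP => i; rewrite !mxE big_ord1; congr (_ * _).
  by rewrite mxE; apply: eq_bigr => j _; rewrite mxE.
by rewrite mulmxDr !outerE.
Qed.

Definition curve_err d := curve n (s + gamma d) - z - gamma d *: z'.
Definition dcurve_err d := dcurve n (s + gamma d) - z' - gamma d *: z''.
Definition image_err d := (w + alpha d) *: curve_err d + alpha d *: (gamma d *: z').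
Definition preimage_err d := image_err d
  + (edot (mu + beta d) (curve_err d)
     - gamma d * edot (mu + beta d) (gamma d *: z'' + dcurve_err d)) *: e0
  + (edot (mu + beta d) (dcurve_err d) + gamma d * edot (beta d) z'') *: c.

Lemma curve_shiftE d :
  (w + alpha d) *: curve n (s + gamma d) = w *: z + d *m pjac + image_err d.
Proof.
rewrite pjacE /image_err /curve_err; apply/rowP => i.
by rewrite !(mxE _ _ ord0 i); ring.
Qed.

(* Moving the parameters [(w, s, mu)] by [(alpha d, gamma d, beta d)] moves the
   projected point by [d], up to second order. *)
Lemma preimage_shiftE d :
  (w + alpha d) *: curve n (s + gamma d) + normal (s + gamma d) (mu + beta d) =
  (w *: z + normal s mu) + d + preimage_err d.
Proof.
have zE : curve n (s + gamma d) = z + gamma d *: z' + curve_err d.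
  by apply/rowP => i; rewrite !(mxE _ _ ord0 i); ring.
have z'E : dcurve n (s + gamma d) = z' + gamma d *: z'' + dcurve_err d.
  by apply/rowP => i; rewrite !(mxE _ _ ord0 i); ring.
have cE : slope_dir (s + gamma d) = c - gamma d *: e0.
  by rewrite /slope_dir scalerDl opprD addrA.
have bE : beta d = - (d - alpha d *: z - gamma d *: (w *: z' + q *: c)) by [].
have bz := edot_beta_curve d; have bz' := edot_beta_dcurve d.
rewrite curve_shiftE pjacE /normal zE z'E cE /preimage_err.
rewrite !(edotDr (mu + beta d)) !(edotZr _ (mu + beta d)) !edotDl bz bz'.
move: (image_err d) (curve_err d) (dcurve_err d) => I E1 E2.
have -> : - (mu + beta d) =
    - mu + d - alpha d *: z - gamma d *: (w *: z' + q *: c).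
  by rewrite bE opprD opprK !addrA.
move: (beta d) (alpha d) (gamma d) => b al ga.
apply/rowP => i.
by rewrite !(mxE _ _ ord0 i); ring.
Qed.

Section Remainders.
Variable delta : R.
Hypothesis delta_le1 : delta <= 1.
Local Notation ordO := (ordO delta).

Lemma ordO_alpha : ordO 1 alpha.
Proof. exact: (ordO_edot (ordO_id _) (ordO_cst _ _)). Qed.

Lemma ordO_gamma : ordO 1 gamma.
Proof. exact: (ordO_edot (ordO_id _) (ordO_cst _ _)). Qed.

Lemma ordO_beta : ordO 1 beta.
Proof.
apply/ordON/ordOD; first apply/ordOD; first exact: ordO_id.
  by apply/ordON; exact: (ordOZ ordO_alpha (ordO_cst _ _)).
by apply/ordON; exact: (ordOZ ordO_gamma (ordO_cst _ _)).
Qed.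

Hypothesis gamma_le1 : forall h, `|h| <= delta -> `|gamma h| <= 1.

(** The Taylor bounds are quadratic in the shift [gamma h] of [s], which is itself [O(|h|)]. *)
Lemma ordO_sqr_gamma (V : normedModType R) (f : 'rV[R]_N -> V) (C : R) : 0 <= C ->
  (forall h, `|h| <= delta -> `|f h| <= C * gamma h ^+ 2) -> ordO 2 f.
Proof.
move=> C0 fC; have [B B0 Bg] := ordO_gamma; exists (C * B ^+ 2).
  by rewrite mulr_ge0// sqr_ge0.
move=> h hd; rewrite (le_trans (fC h hd))// -mulrA ler_wpM2l//.
rewrite -exprMn -[gamma h ^+ 2]real_normK ?num_real// lerXn2r ?nnegrE ?mulr_ge0//.
exact: Bg.
Qed.

Lemma ordO_curve_err : ordO 2 curve_err.
Proof.
apply: (@ordO_sqr_gamma _ _ (D%:R ^+ 2 * (`|s| + 1) ^+ D)).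
  by apply: mulr_ge0; rewrite exprn_ge0// addr_ge0.
by move=> h hd; apply: curve_taylor1; exact: gamma_le1.
Qed.

Lemma ordO_dcurve_err : ordO 2 dcurve_err.
Proof.
apply: (@ordO_sqr_gamma _ _ (D%:R * (D%:R ^+ 2 * (`|s| + 1) ^+ D))).
  by apply: mulr_ge0 => //; apply: mulr_ge0; rewrite exprn_ge0// addr_ge0.
by move=> h hd; apply: dcurve_taylor1; exact: gamma_le1.
Qed.

Lemma ordO_image_err : ordO 2 image_err.
Proof.
apply: ordOD.
  apply: (ordOZ (k := 0) _ ordO_curve_err).
  by apply: ordOD (ordO_cst _ _) (ordO_le delta_le1 _ ordO_alpha).
exact: (ordOZ ordO_alpha (ordOZ ordO_gamma (ordO_cst _ _))).
Qed.

(** Every summand contains a Taylor remainder or two factors of first order. *)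
Lemma ordO_preimage_err : ordO 2 preimage_err.
Proof.
have nu0 : ordO 0 (fun h => mu + beta h).
  by apply: ordOD (ordO_cst _ _) (ordO_le delta_le1 _ ordO_beta).
apply: ordOD; first (apply: ordOD; first exact: ordO_image_err).
  apply: (ordOZ (k := 2) (l := 0) _ (ordO_cst _ _)); apply: ordOD.
    exact: (ordO_edot nu0 ordO_curve_err).
  apply: ordON; apply: (ordOZ (V := R) (k := 1) (l := 1) ordO_gamma).
  apply: (ordO_edot nu0); apply: ordOD.
    exact: (ordOZ ordO_gamma (ordO_cst _ _)).
  exact: (ordO_le delta_le1 _ ordO_dcurve_err).
apply: (ordOZ (k := 2) (l := 0) _ (ordO_cst _ _)); apply: ordOD.
  exact: (ordO_edot nu0 ordO_dcurve_err).
apply: (ordOZ (V := R) (k := 1) (l := 1) ordO_gamma).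
exact: (ordO_edot ordO_beta (ordO_cst _ _)).
Qed.

End Remainders.

Lemma ordO1_small (V : normedModType R) (f : 'rV[R]_N -> V) (e : R) :
  ordO 1 1 f -> 0 < e ->
  exists2 delta, 0 < delta <= 1 & forall h, `|h| <= delta -> `|f h| <= e.
Proof.
move=> [C C0 Cf] e0; have C1 : 0 < C + 1 by rewrite ltr_wpDl.
exists (Num.min 1 (e / (C + 1))).
  by rewrite lt_min ltr01 divr_gt0// ge_min lexx.
move=> h; rewrite le_min => /andP[h1 hC]; rewrite (le_trans (Cf h h1))// expr1.
move: hC; rewrite ler_pdivlMr// => hC; rewrite (le_trans _ hC)// mulrC.
by rewrite ler_wpM2l// lerDl.
Qed.

(** For small [h] the shifted parameters remain where [projection_curve] and the Taylor bounds
    apply; the uniform bound [m] on [mu] leaves room for [beta] in every direction. *)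
Lemma parameters_stay_positive : exists2 delta, 0 < delta <= 1 &
  forall h, `|h| <= delta -> [/\ `|gamma h| <= 1, 0 <= s + gamma h,
    0 <= w + alpha h & forall i, 0 <= (mu + beta h) ord0 i].
Proof.
have e0 : 0 < Num.min 1 s by rewrite lt_min ltr01.
have [d1 d1P g1] := ordO1_small (ordO_gamma 1) e0.
have [d2 d2P a2] := ordO1_small (ordO_alpha 1) w_gt0.
have [d3 d3P b3] := ordO1_small (ordO_beta 1) m_gt0.
exists (Num.min d1 (Num.min d2 d3)).
  move: d1P d2P d3P => /andP[d10 d11] /andP[d20 _] /andP[d30 _].
  by rewrite !lt_min ge_min d10 d20 d30 d11.
move=> h; rewrite !le_min => /and3P[h1 h2 h3].
have := g1 h h1; rewrite le_min => /andP[g1h gs].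
split=> //.
- by have := ler_norm (- gamma h); rewrite normrN; lra.
- by have := ler_norm (- alpha h); have := a2 h h2; rewrite normrN; lra.
- move=> i; rewrite mxE.
  have := ler_norm (- beta h ord0 i); have := le_trans (mx_norm_coord (beta h) i) (b3 h h3).
  by have := mu_gem i; rewrite normrN; lra.
Qed.

Lemma projection_at_normal (Pi : 'rV[R]_N -> 'rV[R]_N) :
  (forall x, is_nearest K x (Pi x)) ->
  [/\ Pi (w *: z + normal s mu) = w *: z,
    differentiable Pi (w *: z + normal s mu) &
    forall h, 'd Pi (w *: z + normal s mu) h = h *m pjac].
Proof.
move=> PiP; set a := w *: z + normal s mu.
have Pia : Pi a = w *: z.
  apply/eqP; rewrite -subr_eq0 -normr_le0.
  have mu0 i : 0 <= mu ord0 i by exact: le_trans (ltW m_gt0) (mu_gem i).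
  have := projection_curve (PiP a) (ltW w_gt0) (ltW s_gt0) mu0.
  rewrite subrr => /(le_trans (mx_norm_le_enorm _))/le_trans; apply.
  by rewrite (le_trans (enorm_le_mx_norm _))// normr0 mulr0.
have [delta /andP[d0 d1] dP] := parameters_stay_positive.
have g1 h : `|h| <= delta -> `|gamma h| <= 1 by move=> /dP[].
have [Ci Ci0 CiP] := ordO_image_err d1 g1.
have [Cp Cp0 CpP] := ordO_preimage_err d1 g1.
have PiD h : `|h| <= delta ->
    `|Pi (a + h) - Pi a - (mulmxr pjac) h| <= (N%:R * Cp + Ci) * `|h| ^+ 2.
  move=> hd; have [_ sg wa mub] := dP h hd.
  (* The first summand compares [Pi (a + h)] with the known projection of the shifted point, so
     nonexpansiveness bounds it by [preimage_err]. *)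
  have -> : Pi (a + h) - Pi a - (mulmxr pjac) h =
    (Pi (a + h) - (w + alpha h) *: curve n (s + gamma h)) + image_err h.
    rewrite curve_shiftE Pia /=; move: (image_err h) (h *m pjac) => I J.
    by apply/rowP => i; rewrite !(mxE _ _ ord0 i); ring.
  rewrite (le_trans (ler_normD _ _))// mulrDl lerD ?CiP//.
  rewrite (le_trans (mx_norm_le_enorm _))//.
  rewrite (le_trans (projection_curve (PiP (a + h)) wa sg mub))//.
  rewrite preimage_shiftE -/a opprD addrA subrr sub0r.
  rewrite (le_trans (enorm_le_mx_norm _))// normrN -mulrA ler_wpM2l//.
  exact: CpP.
have [dPi dE] := differentiable_quadratic_remainder (@mulmxr_continuous R N pjac) d0 PiD.
by split=> // h; rewrite dE.
Qed.

End ProjectionDerivative.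

(** * Lower bound on the semismoothness residual *)

Section NotSemismooth.
Context {R : realType} {n : nat}.
Local Notation N := (n.+3).
Local Notation D := (2 ^ n.+1)%N.
Local Notation z := (@curve R n).
Local Notation z' := (@dcurve R n).
Local Notation z'' := (@ddcurve R n).
Local Notation K := (spectrahedron 0 (@chain_mx R n)).
Local Notation elast := (delta_mx ord0 ord_max : 'rV[R]_N).
Local Notation one := (const_mx 1 : 'rV[R]_N).
Local Notation e0 := (delta_mx ord0 (inord 0) : 'rV[R]_N).

(** Rewriting with this makes the predecessors [D.-1] and [D.-2] genuine subtractions. *)
Lemma top_deg_eqSS : exists k, D = k.+2.
Proof.
have D2 : (2 <= D)%N by rewrite -[leqLHS]expn1 leq_exp2l.
by exists (D - 2)%N; rewrite -[RHS]addn2 subnK.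
Qed.

Lemma normal_last s :
  normal s elast = s ^+ D *: e0 + (D%:R * s ^+ D.-1) *: slope_dir s - elast.
Proof. by rewrite /normal !edot_delta_l !mxE. Qed.

Lemma normalDZ s (u v : 'rV[R]_N) (t : R) :
  normal s (u + t *: v) = normal s u + t *: normal s v.
Proof.
rewrite /normal !edotDl !edotZl; apply/rowP => i.
by rewrite !(mxE _ _ ord0 i); ring.
Qed.

(** Case [w = s = 0] of [projection_curve]: since [D >= 2], [normal 0 elast] is [- elast]. *)
Lemma projection_base (Pi : 'rV[R]_N -> 'rV[R]_N) :
  (forall x, is_nearest K x (Pi x)) -> Pi (- elast) = 0.
Proof.
move=> PiP; have el0 i : 0 <= elast ord0 i by rewrite mxE.
have := projection_curve (PiP (- elast)) (lexx 0) (lexx 0) el0.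
rewrite normal_last; have [k ->] := top_deg_eqSS.
rewrite /= !expr0n /= mulr0 !scale0r !add0r subr0 subrr.
move=> /(le_trans (mx_norm_le_enorm _)) h; apply/eqP; rewrite -normr_le0.
by rewrite (le_trans h)// (le_trans (enorm_le_mx_norm _))// normr0 mulr0.
Qed.

Lemma norm_delta_le1 i : `|delta_mx ord0 i : 'rV[R]_N| <= 1.
Proof. by apply: mx_norm_leP => // j; rewrite mxE ger0_norm// lern1 leq_b1. Qed.

Variable s : R.
Hypotheses (s_gt0 : 0 < s) (s_le1 : s <= 1) (s_small : 2 * N%:R * D%:R * s <= 1).
Let s_ge0 : 0 <= s := ltW s_gt0.
(** [tau] serves both as the weight [w] and as the lower bound on [mu]: the latter becomes strictly
    positive while the point stays within [O(tau)] of [- elast]. *)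
Let tau := s ^+ D.-1.
Let mu : 'rV[R]_N := elast + tau *: one.

Let tau_gt0 : 0 < tau. Proof. exact: exprn_gt0. Qed.

Lemma mu_ge_tau i : tau <= mu ord0 i.
Proof. by rewrite !mxE mulr1 lerDr. Qed.

Lemma ddcurve_ge0 i : 0 <= z'' s ord0 i.
Proof. by rewrite mxE !mulr_ge0// exprn_ge0. Qed.

(** The last coordinate alone contributes [D (D-1) s^(D-2)]; the other terms are nonnegative. *)
Lemma edot_mu_ddcurve_ge : D%:R * s ^+ D.-2 <= edot mu (z'' s).
Proof.
rewrite /mu edotDl edotZl edot_delta_l.
have h1 : D%:R * s ^+ D.-2 <= z'' s ord0 ord_max.
  rewrite mxE /=; have [k ->] := top_deg_eqSS => /=.
  by rewrite ler_wpM2l// ler_peMl ?exprn_ge0// ler1n.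
rewrite (le_trans h1)// lerDl mulr_ge0 ?(ltW tau_gt0)// sumr_ge0// => i _.
by rewrite mulr_ge0 ?ddcurve_ge0// mxE.
Qed.

Lemma edot_mu_ddcurve_gt0 : 0 < edot mu (z'' s).
Proof.
by apply: lt_le_trans edot_mu_ddcurve_ge; rewrite mulr_gt0 ?exprn_gt0.
Qed.

Lemma norm_curve_le1 : `|z s| <= 1.
Proof.
apply: mx_norm_leP => // i; rewrite mxE ger0_norm ?exprn_ge0//.
by rewrite exprn_ile1.
Qed.

Lemma norm_dcurve_le : `|z' s| <= D%:R.
Proof.
apply: mx_norm_leP => // i; rewrite mxE ger0_norm ?mulr_ge0 ?exprn_ge0//.
rewrite -[leRHS]mulr1 ler_pM ?exprn_ge0 ?exprn_ile1// ler_nat.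
exact: chain_deg_le.
Qed.

(** A coordinate of degree [d > 0] contributes [d s^(2d-1) <= D s], and degree 0 contributes
    nothing. *)
Lemma edot_curve_dcurve_le : edot (z s) (z' s) <= N%:R * (D%:R * s).
Proof.
have -> : N%:R * (D%:R * s) = \sum_(i < N) D%:R * s.
  by rewrite sumr_const card_ord mulr_natl.
apply: ler_sum => i _; rewrite !mxE mulrCA.
have := chain_deg_le i; case: (chain_deg i) => [|d] dD.
  by rewrite mul0r mulr_ge0.
rewrite ler_pM ?mulr_ge0 ?exprn_ge0// ?ler_nat//.
rewrite -exprD /= addSn exprS ler_piMr// exprn_ile1//.
Qed.

Lemma edot_curve_dcurve_ge0 : 0 <= edot (z s) (z' s).
Proof. by apply: sumr_ge0 => i _; rewrite !mxE !mulr_ge0 ?exprn_ge0. Qed.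

(** The numerator of [alpha elast] is [Q s^D] minus a cross term that [s_small] keeps below half of
    it, and [pdet <= N Q]. *)
Lemma alpha_last_ge : s ^+ D / (2 * N%:R) <= alpha tau s mu elast.
Proof.
have pdet0 := pdet_gt0 tau_gt0 edot_mu_ddcurve_gt0.
rewrite alphaE ler_pdivlMr// !edot_delta_l.
have -> : z s ord0 ord_max = s ^+ D by rewrite mxE.
have -> : z' s ord0 ord_max = D%:R * tau by rewrite mxE.
have W0 := edot_ge0 (z' s); have q0 := edot_mu_ddcurve_ge.
have Y0 := edot_curve_dcurve_ge0; have YN := edot_curve_dcurve_le.
have ZN : edot (z s) (z s) <= N%:R.
  rewrite (le_trans (ler_norm _))// (le_trans (norm_edot_le _ _))//.
  by rewrite ler_piMr// mulr_ile1// norm_curve_le1.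
have Z1 := edot_curve_ge1 s.
set Q := tau * edot (z' s) (z' s) + edot mu (z'' s).
have QD : D%:R * s ^+ D.-2 <= Q.
  by rewrite (le_trans q0)// lerDr mulr_ge0// ltW.
have Q0 : 0 <= Q by rewrite (le_trans _ QD)// mulr_ge0// exprn_ge0.
have pdetQ : pdet tau s mu <= N%:R * Q.
  rewrite /pdet -/Q (@le_trans _ _ (edot (z s) (z s) * Q))//.
    by rewrite gerBl mulr_ge0 ?sqr_ge0// ltW.
  by rewrite ler_wpM2r.
have sD0 : 0 <= s ^+ D by rewrite exprn_ge0.
have N0 : N%:R != 0 :> R by rewrite pnatr_eq0.
apply: (@le_trans _ _ (s ^+ D / (2 * N%:R) * (N%:R * Q))).
  by rewrite ler_wpM2l// mulr_ge0// invr_ge0.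
have -> : s ^+ D / (2 * N%:R) * (N%:R * Q) = s ^+ D * Q / 2 by field.
have tau2 : tau * tau = s ^+ D * s ^+ D.-2.
  rewrite /tau; have [k ->] := top_deg_eqSS => /=.
  by rewrite -!exprD addSnnS addnC.
(* By [tau2], the cross term is at most [2 N D s] times [s^D (D s^(D-2)) / 2], and
   [D s^(D-2) <= Q]. *)
have tauY : tau * edot (z s) (z' s) * (D%:R * tau) <= s ^+ D * Q / 2.
  apply: (@le_trans _ _ (tau * (N%:R * (D%:R * s)) * (D%:R * tau))).
    by rewrite ler_wpM2r ?mulr_ge0 ?(ltW tau_gt0)// ler_wpM2l// ltW.
  have -> : tau * (N%:R * (D%:R * s)) * (D%:R * tau) =
      (2 * N%:R * D%:R * s) * ((s ^+ D) * (D%:R * s ^+ D.-2) / 2).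
    by rewrite [_ * (_ * _ ^+ D.-2)]mulrCA -tau2; field.
  apply: (@le_trans _ _ (s ^+ D * (D%:R * s ^+ D.-2) / 2)).
    by rewrite ler_piMl// divr_ge0// !mulr_ge0// exprn_ge0.
  by rewrite ler_wpM2r// ler_wpM2l.
by rewrite mulrC [Q * _]mulrC; lra.
Qed.

(** Sum of max-norm bounds: 1 for [z s], 1 for [s *: e0], [2 D] for the slope term,
    [N (1 + 2 D) + 1] for [normal s one]; the outer [N] passes to the Euclidean norm. *)
Definition dist_const : R := N%:R * (3 + 2 * D%:R + N%:R * (1 + 2 * D%:R)).

(** The base point cancels the [- elast] in [normal s mu], and since [s^D = tau s] all remaining
    terms carry the factor [tau]. *)
Lemma enorm_increment_le :
  enorm (tau *: z s + normal s mu + elast) <= dist_const * tau.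
Proof.
have -> : tau *: z s + normal s mu + elast =
    tau *: (z s + s *: e0 + D%:R *: slope_dir s + normal s one).
  rewrite /mu normalDZ normal_last.
  have -> : s ^+ D = tau * s.
    by rewrite /tau -exprSr prednK// expn_gt0.
  rewrite -/tau; move: (normal s _) (slope_dir _) (z s) => u c v.
  by apply/rowP => i; rewrite !(mxE _ _ ord0 i); ring.
have c2 : `|slope_dir s : 'rV[R]_N| <= 2.
  apply: (le_trans (ler_normB (delta_mx ord0 (inord 1) : 'rV[R]_N) (s *: e0))).
  rewrite normrZ -[leRHS]/(1 + 1) lerD ?norm_delta_le1//.
  by rewrite mulr_ile1 ?norm_delta_le1// ger0_norm.
have one1 : `|one| <= 1.
  by apply: mx_norm_leP => // i; rewrite mxE normr1.
have nu : `|normal s one| <= N%:R * (1 + 2 * D%:R) + 1.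
  pose u : 'rV[R]_N := edot one (z s) *: e0.
  pose v : 'rV[R]_N := edot one (z' s) *: slope_dir s.
  apply: (le_trans (ler_normB (u + v) one)); apply: lerD => //.
  apply: (le_trans (ler_normD u v)); rewrite !normrZ.
  rewrite mulrDr mulr1 lerD//.
    rewrite -[leRHS]mulr1 ler_pM ?norm_delta_le1//.
    rewrite (le_trans (norm_edot_le _ _))// ler_piMr// mulr_ile1//.
    exact: norm_curve_le1.
  rewrite [2 * _]mulrC mulrA ler_pM// (le_trans (norm_edot_le _ _))//.
  by rewrite ler_wpM2l// -[leRHS]mul1r ler_pM// norm_dcurve_le.
rewrite (le_trans (enorm_le_mx_norm _))// normrZ (ger0_norm (ltW tau_gt0)).
rewrite /dist_const [tau * _]mulrC mulrA ler_wpM2r// ?(ltW tau_gt0)// ler_wpM2l//.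
have h1 := norm_curve_le1.
have h2 : `|s *: e0| <= 1.
  by rewrite normrZ mulr_ile1 ?norm_delta_le1// ger0_norm.
have h3 : `|D%:R *: slope_dir s : 'rV[R]_N| <= D%:R * 2.
  by rewrite normrZ normr_nat ler_wpM2l.
have := ler_normD (z s + s *: e0 + D%:R *: slope_dir s) (normal s one).
have := ler_normD (z s + s *: e0) (D%:R *: slope_dir s).
have := ler_normD (z s) (s *: e0).
lra.
Qed.

(** [normal s mu] is orthogonal to [z s] and [z' s], so [alpha] sees only [tau *: z s]. This is
    Euler's identity for the projection onto a cone, read on the weight. *)
Lemma alpha_point : alpha tau s mu (tau *: z s + normal s mu) = tau.
Proof.
have pdet0 := pdet_gt0 tau_gt0 edot_mu_ddcurve_gt0.
rewrite alphaE (edotDl _ _ (z s)) (edotDl _ _ (z' s)) !edotZl.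
rewrite edot_normal_curve edot_normal_dcurve !addr0.
apply: (mulIf (lt0r_neq0 pdet0)); rewrite divfK ?lt0r_neq0// /pdet; ring.
Qed.

(** For [V] the Jacobian, coordinate 0 of the residual is [tau - alpha (a + elast) = - alpha elast]
    by [alpha_point], and [alpha_last_ge] bounds it from below. *)
Lemma semismooth_residual_ge (Pi : 'rV[R]_N -> 'rV[R]_N) (C p : R) :
  (forall x, is_nearest K x (Pi x)) -> 0 <= C -> 0 <= p ->
  (forall V, clarke Pi (tau *: z s + normal s mu) V ->
    enorm (Pi (tau *: z s + normal s mu) - Pi (- elast) -
           (tau *: z s + normal s mu + elast) *m V) <=
    C * (enorm (tau *: z s + normal s mu + elast)) `^ (1 + p)) ->
  s ^+ D / (2 * N%:R) <= C * (dist_const * tau) `^ (1 + p).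
Proof.
move=> PiP C0 p0 semi.
have [Pia dPi dE] := projection_at_normal tau_gt0 s_gt0 tau_gt0 mu_ge_tau
  edot_mu_ddcurve_gt0 PiP.
move: (semi _ (clarke_jac dPi)); rewrite Pia (projection_base PiP) subr0.
rewrite /jac mul_rV_lin1 /= dE pjacE.
move: (tau *: z s + normal s mu) alpha_point enorm_increment_le => a aE aN.
(* In coordinate 0, [z s] equals 1 and [z' s] equals 0, so only [alpha] survives. *)
move=> /(le_trans (mx_norm_le_enorm _))/(le_trans (mx_norm_coord _ (inord 0))).
rewrite !mxE inordK//= expr0 mul0r !mulr0 addr0 !mulr1.
have -> : alpha tau s mu (a + elast) = tau + alpha tau s mu elast.
  by rewrite -[X in _ = X + _]aE /alpha edotDl.
rewrite opprD addrA subrr sub0r normrN => h.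
rewrite (le_trans alpha_last_ge)// (le_trans (ler_norm _))// (le_trans h)//.
rewrite ler_wpM2l// ge0_ler_powR ?nnegrE ?addr_ge0 ?enorm_ge0//.
exact: le_trans (enorm_ge0 _) aN.
Qed.

End NotSemismooth.

(** * Choice of the scale and the contradiction *)

Lemma projection_not_semismooth (R : realType) (n : nat) (p : R)
    (Pi : 'rV[R]_n.+3 -> 'rV[R]_n.+3) :
  0 < p -> 2 <= (2 ^ n.+1).-1%:R * p ->
  (forall x, is_nearest (spectrahedron 0 (@chain_mx R n)) x (Pi x)) ->
  ~ semismooth_order p Pi (- delta_mx ord0 ord_max).
Proof.
move=> p0 pD PiP [_ [C [delta [C0 [d0 semi]]]]].
set D := (2 ^ n.+1)%N in pD.
have [k Dk] := top_deg_eqSS : exists k, D = k.+2.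
pose E : R := @dist_const R n.
have E0 : 0 < E.
  have D0 : 0 <= D%:R :> R by [].
  have ND0 : 0 <= n.+3%:R * (1 + 2 * D%:R) :> R by rewrite mulr_ge0//; lra.
  by rewrite /E /dist_const mulr_gt0// -/D; lra.
pose B := 2 * n.+3%:R * (C * E `^ (1 + p)).
have B0 : 0 < B by rewrite !mulr_gt0// powR_gt0.
have ND0 : 0 < 2 * n.+3%:R * D%:R :> R by rewrite !mulr_gt0// ltr0n expn_gt0.
(* The inverse of a sum of positive terms: each summand yields one of the smallness conditions [s1],
   [sND], [sB], [sE]. *)
pose s := (1 + 2 * n.+3%:R * D%:R + 2 * B + 2 * E / delta)^-1.
have Ed0 : 0 < E / delta by rewrite divr_gt0.
have den0 : 0 < 1 + 2 * n.+3%:R * D%:R + 2 * B + 2 * E / delta by rewrite -mulrA; lra.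
have s0 : 0 < s by rewrite invr_gt0.
have smallP r : r <= 1 + 2 * n.+3%:R * D%:R + 2 * B + 2 * E / delta -> r * s <= 1.
  by move=> rle; rewrite ler_pdivrMr// mul1r.
have s1 : s <= 1 by rewrite -[s]mul1r smallP// -[2 * E / _]mulrA; lra.
have sND : 2 * n.+3%:R * D%:R * s <= 1 by rewrite smallP// -[2 * E / _]mulrA; lra.
have sB : 2 * B * s <= 1 by rewrite smallP// -[2 * E / _]mulrA; lra.
have sE : 2 * E / delta * s <= 1 by rewrite smallP//; lra.
pose tau := s ^+ D.-1.
have tau_s : tau <= s by rewrite /tau Dk /= exprS ler_piMr ?(ltW s0)// exprn_ile1// ltW.
set mu := (delta_mx ord0 ord_max + tau *: const_mx 1 : 'rV[R]_n.+3).
set a := tau *: curve n s + normal s mu.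
have aN := enorm_increment_le s0 s1 : enorm (a + delta_mx ord0 ord_max) <= E * tau.
have aE : - delta_mx ord0 ord_max + (a + delta_mx ord0 ord_max) = a.
  by rewrite addrC addrK.
have ad : enorm (a + delta_mx ord0 ord_max) < delta.
  rewrite (le_lt_trans aN)// (@le_lt_trans _ _ (E * s))//.
    by rewrite ler_wpM2l// ltW.
  move: sE; rewrite mulrAC ler_pdivrMr// mul1r.
  have : 0 < E * s by rewrite mulr_gt0.
  by rewrite -(mulrA 2); lra.
have semi_a V := semi _ ad V; rewrite aE in semi_a.
have := semismooth_residual_ge s0 s1 sND PiP (ltW C0) (ltW p0) semi_a.
rewrite -/D -/tau -/E powRM ?(ltW E0) ?exprn_ge0 ?(ltW s0)// leNgt => /negP; apply.
(* The exponents compare because [(D-1)(1+p) >= (D-1) + 2 = D + 1]. *)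
have tauD : tau `^ (1 + p) <= s ^+ D.+1.
  rewrite -powR_mulrn ?(ltW s0)// /tau -powR_mulrn ?(ltW s0)// -powRrM.
  rewrite ger_powR ?s0// mulrDr mulr1; move: pD; rewrite Dk /=.
  have -> : k.+3%:R = k.+1%:R + 2 :> R by rewrite -natrD addn2.
  by move=> pD; rewrite lerD2l.
have sD0 : 0 < s ^+ D by rewrite exprn_gt0.
rewrite ltr_pdivlMr ?mulr_gt0//.
apply: (@le_lt_trans _ _ (B * s * s ^+ D)).
  have -> : B * s * s ^+ D = C * (E `^ (1 + p) * s ^+ D.+1) * (2 * n.+3%:R).
    by rewrite /B exprS; ring.
  by rewrite ler_wpM2r// ler_wpM2l ?(ltW C0)// ler_wpM2l// powR_ge0.
(* [B s <= 1/2 < 1] makes the upper bound strictly smaller than the residual. *)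
rewrite gtr_pMl//; have : 0 < B * s by rewrite mulr_gt0.
by move: sB; rewrite -(mulrA 2); lra.
Qed.

Theorem theorem1 (R : realType) (p : R) (hp : 0 < p) :
  exists (N m : nat), (0 < N)%N /\ (0 < m)%N /\
  exists (A0 : 'M[R]_m) (A : 'I_N -> 'M[R]_m),
    symmx A0 /\ (forall i, symmx (A i)) /\
    exists Pi : 'rV[R]_N -> 'rV[R]_N,
      (forall x, is_nearest (spectrahedron A0 A) x (Pi x)) /\
      exists x : 'rV[R]_N, ~ semismooth_order p Pi x.
Proof.
(* Any [n >= 2 / p] works, because [n <= 2^(n+1) - 1]. *)
pose n := Num.bound (2 / p).
have np : 2 <= (2 ^ n.+1).-1%:R * p.
  rewrite -ler_pdivrMr//.
  apply: (@le_trans _ _ n%:R); first by rewrite ltW// archi_boundP// divr_ge0// ltW.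
  by rewrite ler_nat -ltnS prednK ?expn_gt0// ltnW// ltn_expl.
exists n.+3, (n.+1 + n.+1)%N; split=> //; split=> //.
exists 0, (@chain_mx R n); split; first by rewrite /symmx trmx0.
split; first exact: chain_mx_sym.
have Kc := spectrahedron0_closed (@chain_mx_sym R n).
have K0 : spectrahedron 0 (@chain_mx R n) !=set0.
  by exists (0 *: curve n 0); exact: curve_chain_cone.
have [Pi PiP] := choice (fun x => nearest_exists x Kc K0).
exists Pi; split=> //; exists (- delta_mx ord0 ord_max).
exact: projection_not_semismooth.
Qed.
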